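(* Let $l\ge1$, $m\ge2$, $n\ge1$, let $C$ be a generalized Dellac configuration of size $n$ with type $(l,m)$, let $\phi=\phi(C)$ and let $L$ be its length. For $1\le i\le L/2$, write $i=pl+q$ with $p\ge0$, $1\le q\le l$, and set $\phi^{o}_i=\phi_{2lp+q}$ and $\phi^{e}_i=\phi_{l(2p+1)+q}$; let $\phi^{e}_{<}$ be the increasing rearrangement of $\phi^{e}=\phi^e_1\cdots\phi^e_{L/2}$. Then $$\mathrm{inv}(C)=\mathrm{Area}(\phi^{e}_{<})+\mathrm{inv}(\phi^{e})+\mathrm{inv}(\phi^{o}).$$
   Context: A generalized Dellac configuration of size $n$ with type $(l,m)$ is a set of $lmn$ boxes (''dots'') in a grid of width $ln$ (columns from left to right) and height $mn$ (rows $1,\dots,mn$ from bottom to top), such that each row contains exactly $l$ dots, each column contains exactly $m$ dots, and a dot in row $i$, column $j$ satisfies $\lceil j/l\rceil\le i\le\lceil j/l\rceil+(m-1)n$. $\mathrm{inv}(C)$ is the number of pairs of dots one of which lies strictly above and strictly to the left of the other. For a word $w$, $\mathrm{inv}(w)$ is the number of pairs $i<j$ with $w_i>w_j$. Labels: if $mn$ is even, every dot in row $i$ ($1\le i\le mn/2$) gets label $2i+n(m-2)+2$ and every dot in row $mn/2+i$ ($1\le i\le mn/2$) gets label $2i-1$. If $mn$ is odd, every dot in row $i$ ($1\le i\le (mn-1)/2$) gets label $2i+n(m-2)+1$ and every dot in row $(mn-1)/2+i$ ($1\le i\le (mn+1)/2$) gets label $2i-1$. $\mathrm{word}(C)$ is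 obtained by reading the labels column by column from left to right, each column from bottom to top. Writing $a^l$ for $l$ copies of $a$: for $mn$ even, $w_1=2^l4^l\cdots(n(m-2)+2)^l$ and $w_2=(mn+1)^l(mn+3)^l\cdots(2n(m-1)+1)^l$; for $mn$ odd, $w_1=2^l4^l\cdots((m-2)n+1)^l$ and $w_2=(mn+2)^l(mn+4)^l\cdots(2(m-1)n-1)^l$. Put $\phi_1(C)=w_1\,\mathrm{word}(C)\,w_2$; each value $k\in\{1,\dots,L/l\}$ occurs exactly $l$ times in it, where $L$ is its length. $\phi(C)=\beta$ is the permutation of $\{1,\dots,L\}$ with $\beta_{l(k-1)+p}=i_p$ ($1\le p\le l$) whenever value $k$ occurs in $\phi_1(C)$ at positions $i_1<\dots<i_l$. For an increasing sequence $\xi=\xi_1<\dots<\xi_N$ of positive integers with $\xi_i\le 2i-1$, $\mathcal D(\xi)$ is the Dyck path of length $2N$ whose $k$-th step is an up step $(1,1)$ iff $k\in\{\xi_1,\dots,\xi_N\}$ (other steps are down steps $(1,-1)$), and $\mathrm{Area}(\xi)$ is the number of unit (tilted) boxes lying above $\mathcal D(\xi)$ and below the highest Dyck path ($N$ up steps followed by $N$ down steps); equivalently $\mathrm{Area}(\xi)=\sum_{i=1}^N(\xi_i-i)$. *)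

(* Defs.v *)
From mathcomp Require Import all_boot all_order all_algebra.

Set Implicit Arguments.
Unset Strict Implicit.
Unset Printing Implicit Defensive.

(* Boxes are pairs (column, row), both counted from 0 (columns from the left,
   rows from the bottom): the column and row numbers counted from 1 are
   b.1.+1 and b.2.+1, and ceil ((b.1 + 1) / l) = (b.1 %/ l).+1. *)
Definition dellac (l m n : nat) (C : {set 'I_(l * n) * 'I_(m * n)}) : Prop :=
  [/\ #|C| = l * m * n,
      forall r : 'I_(m * n), #|[set b in C | b.2 == r]| = l,
      forall c : 'I_(l * n), #|[set b in C | b.1 == c]| = m
    & forall b, b \in C ->
        (b.1 %/ l).+1 <= b.2.+1 <= (b.1 %/ l).+1 + (m - 1) * n].

(* Pairs (d, d') of dots with d strictly above and strictly left of d'. *)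
Definition inv_dots (W H : nat) (C : {set 'I_W * 'I_H}) : nat :=
  #|[set dd : ('I_W * 'I_H) * ('I_W * 'I_H) |
      [&& dd.1 \in C, dd.2 \in C, dd.1.1 < dd.2.1 & dd.2.2 < dd.1.2]]|.

Definition inv_word (w : seq nat) : nat :=
  #|[set ij : 'I_(size w) * 'I_(size w) |
      (ij.1 < ij.2) && (nth 0 w ij.2 < nth 0 w ij.1)]|.

(* Label of the dots of row r, where r is counted from 1. *)
Definition label (m n r : nat) : nat :=
  let h := (m * n)./2 in
  if r <= h then
    if odd (m * n) then 2 * r + n * (m - 2) + 1 else 2 * r + n * (m - 2) + 2
  else 2 * (r - h) - 1.

Definition word (l m n : nat) (C : {set 'I_(l * n) * 'I_(m * n)}) : seq nat :=
  flatten [seq [seq label m n r.+1 | r : 'I_(m * n) <- enum 'I_(m * n)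
                                   & (c, r) \in C]
          | c : 'I_(l * n) <- enum 'I_(l * n)].

(* a^l (a+2)^l ... b^l, empty if b < a *)
Definition step2_word (l a b : nat) : seq nat :=
  flatten [seq nseq l k | k <- iota a (b.+1 - a) & odd k == odd a].

Definition w1 (l m n : nat) : seq nat :=
  if odd (m * n) then step2_word l 2 ((m - 2) * n + 1)
  else step2_word l 2 (n * (m - 2) + 2).

Definition w2 (l m n : nat) : seq nat :=
  if odd (m * n) then step2_word l (m * n + 2) (2 * (m - 1) * n - 1)
  else step2_word l (m * n + 1) (2 * n * (m - 1) + 1).

Definition phi1 (l m n : nat) (C : {set 'I_(l * n) * 'I_(m * n)}) : seq nat :=
  w1 l m n ++ word C ++ w2 l m n.

(* The positions, counted from 1, of the letter k in w, in increasing order. *)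
Definition positions (k : nat) (w : seq nat) : seq nat :=
  [seq i <- iota 1 (size w) | nth 0 w i.-1 == k].

(* One-line notation of the permutation: the j-th entry (from 0) is beta_(j+1),
   and j + 1 = l * (k - 1) + p with k = (j %/ l).+1 and p = (j %% l).+1. *)
Definition phi (l m n : nat) (C : {set 'I_(l * n) * 'I_(m * n)}) : seq nat :=
  mkseq (fun j => nth 0 (positions (j %/ l).+1 (phi1 C)) (j %% l))
        (size (phi1 C)).

(* Here index i stands for i + 1 = p * l + q with p = i %/ l, q = (i %% l).+1. *)
Definition odd_part (l : nat) (s : seq nat) : seq nat :=
  mkseq (fun i => nth 0 s (2 * l * (i %/ l) + i %% l)) (size s)./2.

Definition even_part (l : nat) (s : seq nat) : seq nat :=
  mkseq (fun i => nth 0 s (l * (2 * (i %/ l) + 1) + i %% l)) (size s)./2.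

(* xi_1 < ... < xi_N positive with xi_i <= 2 i - 1 (nth counts from 0) *)
Definition dyck_seq (xi : seq nat) : Prop :=
  [/\ sorted ltn xi, all (leq 1) xi
    & forall i, i < size xi -> nth 0 xi i <= 2 * i + 1].

(* Ordinate of the path D(xi) at abscissa x. *)
Definition dyck_height (xi : seq nat) (x : nat) : int :=
  (\sum_(1 <= k < x.+1) (if k \in xi then 1 else -1 : int))%R.

(* A tilted unit box is encoded by its lowest vertex (x, y), its highest vertex
   being (x, y + 2); since the paths have steps (1, 1) and (1, -1), the box lies
   above (resp. below) a path as soon as its lowest (resp. highest) vertex does.
   The highest Dyck path is the one of the sequence 1, ..., N. *)
Definition area (xi : seq nat) : nat :=
  let N := size xi in
  #|[set xy : 'I_(2 * N).+1 * 'I_N.+1 |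
      [&& odd xy.1 == odd xy.2,
          (dyck_height xi xy.1 <= xy.2%:Z)%R
        & ((xy.2 + 2)%:Z <= dyck_height (iota 1 N) xy.1)%R]]|.

(* Main.v *)
(* Even labels are those of the low rows 1..h and odd labels those of the high
   rows, h being the half of mn.  A pair of dots is an inversion of C exactly
   when its letters, read in the order of word(C), form one of three patterns:
   a descent between two even letters, a descent between two odd letters, or an
   odd letter followed by an even one (in a single column the even letters come
   first).  The prefix w_1 and the suffix w_2 create no such pattern.  Since
   phi(C) lists positions by increasing letter, the first two kinds are counted by
   inv(phi^e) and inv(phi^o), and the third one by the sum of xi_i - i over the
   increasing sequence xi of the positions of even letters, that is, by the area.

   The Dyck condition says that no prefix of phi_1(C) has more odd letters than
   even ones.  With c columns read, row r (from 0) has at most c - l(r - (m-1)n)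
   dots and at least l - (l(r+1) - c), because of the bounds on the positions of
   dots; summing, there are at least c low dots and at most l((m-1)n - h) + c
   high ones, and w_1 has at least l((m-1)n - h) even letters. *)
Require Import Defs.
From mathcomp Require Import all_boot all_order all_algebra.
From mathcomp Require Import zify.

(** * Counting ordered pairs in a sequence, and inversions of words *)

Fixpoint npairs {T : Type} (P : rel T) (s : seq T) : nat :=
  if s is x :: s' then count (P x) s' + npairs P s' else 0.

Lemma npairs_cat (T : Type) (P : rel T) (s1 s2 : seq T) :
  npairs P (s1 ++ s2)
    = npairs P s1 + npairs P s2 + \sum_(x <- s1) count (P x) s2.
Proof.
elim: s1 => [|x s1 IH] /=; first by rewrite big_nil addn0.
by rewrite big_cons count_cat IH; lia.
Qed.

Lemma npairs_map (T U : Type) (f : T -> U) (P : rel U) (s : seq T) :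
  npairs P (map f s) = npairs (fun x y => P (f x) (f y)) s.
Proof. by elim: s => //= x s ->; rewrite count_map. Qed.

(** When [s] is listed along an asymmetric [R], the order of places can be read off from [R]. The
    resulting double sum is invariant under permutation of [s], so different listings of the same
    elements become comparable. *)
Lemma npairs_pairwise (T : Type) (R P : rel T) (s : seq T) :
  (forall x y, R x y -> ~~ R y x) -> pairwise R s ->
  npairs P s = \sum_(x <- s) \sum_(y <- s) (R x y && P x y).
Proof.
move=> asymR; elim: s => [|x s IH] /=; first by rewrite big_nil.
case/andP=> Rx /IH ->; rewrite big_cons big_cons.
have -> : R x x = false by apply/negP => Rxx; move: (asymR _ _ Rxx); rewrite Rxx.
rewrite add0n; congr (_ + _).
  rewrite -sum1_count big_mkcond /=.
  elim: s Rx {IH} => [|y s IH] /=; first by rewrite !big_nil.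
  by case/andP=> Rxy /IH {}IH; rewrite !big_cons IH Rxy; case: (P x y).
suff E t : all (R x) t -> \sum_(i <- t) \sum_(y <- s) (R i y && P i y)
    = \sum_(i <- t) \sum_(y <- x :: s) (R i y && P i y) by apply: E.
elim: t => [|y t IHt] /=; first by rewrite !big_nil.
case/andP=> Rxy /IHt {}IHt.
by rewrite !big_cons IHt (negPf (asymR _ _ Rxy)).
Qed.

Lemma inv_wordE (s : seq nat) : inv_word s = npairs (fun x y => y < x) s.
Proof.
rewrite /inv_word -sum1dep_card big_mkcond /=.
rewrite -(pair_bigA _ (fun i j : 'I_(size s) =>
  if (i < j) && (nth 0 s j < nth 0 s i) then 1 else 0)) /=.
elim: s => [|x s IH] /=; first by rewrite big_ord0.
rewrite big_ord_recl big_ord_recl /= add0n; congr (_ + _).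
  rewrite -sum1_count (big_nth 0) big_mkord [RHS]big_mkcond /=.
  by apply: eq_bigr => i _; rewrite add0n.
rewrite -IH; apply: eq_bigr => i _; rewrite big_ord_recl /= add0n.
by apply: eq_bigr => j _.
Qed.

(** * The area above a Dyck path as a number of pairs of steps *)

(** Let xi_1 < ... < xi_k satisfy [e]. Each xi_i adds T + 1 - xi_i to the prefix counts and ends
    xi_i - i pairs, which gives k(T + 1) - k(k + 1)/2 in total; doubling and moving the square avoid
    division and subtraction. *)
Lemma npairs_iota_sum (e : pred nat) (T : nat) :
  2 * (npairs (fun x y => ~~ e x && e y) (iota 1 T)
       + \sum_(x < T.+1) count e (iota 1 x))
    + count e (iota 1 T) * count e (iota 1 T)
  = count e (iota 1 T) * (2 * T + 1).
Proof.
elim: T => [|T IH]; first by rewrite big_ord_recr big_ord0.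
rewrite big_ord_recr.
have -> : iota 1 T.+1 = iota 1 T ++ [:: T.+1] by rewrite -[in LHS](addn1 T) iotaD add1n.
rewrite npairs_cat count_cat /= !addn0.
have -> : \sum_(x <- iota 1 T) (~~ e x && e T.+1 + 0)
   = e T.+1 * count (fun x => ~~ e x) (iota 1 T).
  rewrite -sum1_count [in RHS]big_mkcond /= big_distrr /=.
  by apply: eq_bigr => x _; case: (e x); case: (e T.+1).
have := count_predC e (iota 1 T); rewrite size_iota.
rewrite -[count (predC e) _]/(count (fun x => ~~ e x) (iota 1 T)).
move: (count _ _) (count _ _) (npairs _ _) (\sum_(_ < _) _) IH => c d p s.
by case: (e T.+1) => /=; nia.
Qed.

(** Counts the boxes between two paths on one vertical line, of ordinates [a] and [a + 2 * d]. The
    hypothesis keeps the top candidate [a + 2 * (d - 1)] at most [N]. *)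
Lemma card_parity_interval (a d N : nat) : a + 2 * d <= N.+2 ->
  #|[set y : 'I_N.+1 | [&& odd y == odd a, a <= y & y + 2 <= a + 2 * d]]| = d.
Proof.
elim: d => [|d IH] Hd.
  by apply: eq_card0 => y; rewrite !inE; lia.
have lt : a + 2 * d < N.+1 by lia.
rewrite (cardsD1 (Ordinal lt)) inE /=.
have -> : [&& odd (a + 2 * d) == odd a, a <= a + 2 * d & a + 2 * d + 2 <= a + 2 * d.+1].
  by lia.
rewrite -[in RHS]IH; last lia.
rewrite add1n; congr S; apply: eq_card => y; rewrite !inE -val_eqE /=.
by lia.
Qed.

Lemma dyck_heightE (xi : seq nat) (x : nat) :
  (dyck_height xi x + x%:Z = 2 * (count (mem xi) (iota 1 x))%:Z)%R.
Proof.
rewrite /dyck_height.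
elim: x => [|x IH]; first by rewrite big_geq.
rewrite big_nat_recr //= -[RHS]/(2 * Posz (count (mem xi) (iota 1 x.+1)))%R.
rewrite -[in RHS](addn1 x) iotaD count_cat /= add1n addn0.
move: (bigop _ _ _) (count _ _) IH => s c.
by case: (x.+1 \in xi) => /=; lia.
Qed.

(* On the vertical line of abscissa x there are min x N - E x boxes, where E x is
   the number of up steps among the first x steps. *)
Lemma area_filter (e : pred nat) (N : nat) :
  let xi := [seq x <- iota 1 (2 * N) | e x] in
  size xi = N ->
  (forall x, x <= 2 * N -> count (predC e) (iota 1 x) <= count e (iota 1 x)) ->
  area xi = npairs (fun x y => ~~ e x && e y) (iota 1 (2 * N)).
Proof.
move=> xi sz prefix; rewrite /area sz -sum1dep_card big_mkcond /=.
rewrite -(pair_bigA _ (fun (x : 'I_(2 * N).+1) (y : 'I_N.+1) =>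
  if [&& odd x == odd y, (dyck_height xi x <= y%:Z)%R
       & ((y + 2)%:Z <= dyck_height (iota 1 N) x)%R] then 1 else 0)) /=.
have cE (x : nat) : x <= 2 * N -> count (mem xi) (iota 1 x) = count e (iota 1 x).
  move=> xN; apply: eq_in_count => y; rewrite mem_iota => y1.
  by rewrite /= mem_filter mem_iota; case: (e y) => //=; lia.
have cN (x : nat) : count (fun y => y <= N) (iota 1 x) = minn x N.
  elim: x => [|x IH]; first by rewrite min0n.
  by rewrite -[in LHS](addn1 x) iotaD count_cat IH /= add1n; lia.
have cM (x : nat) : count (mem (iota 1 N)) (iota 1 x) = minn x N.
  rewrite -cN; apply: eq_in_count => y; rewrite mem_iota /= mem_iota; lia.
have leN (x : nat) : x <= 2 * N -> count e (iota 1 x) <= N.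
  move=> xN; rewrite -[leqRHS]sz size_filter -(subnKC xN) iotaD count_cat.
  exact: leq_addr.
have box (x : 'I_(2 * N).+1) :
    \sum_(y < N.+1) (if [&& odd x == odd y, (dyck_height xi x <= y%:Z)%R
       & ((y + 2)%:Z <= dyck_height (iota 1 N) x)%R] then 1 else 0)
    + count e (iota 1 x) = count (fun y => y <= N) (iota 1 x).
  have xN : x <= 2 * N by rewrite -ltnS.
  have := dyck_heightE xi x; rewrite cE //.
  have := dyck_heightE (iota 1 N) x; rewrite cM.
  have := leN _ xN; have := prefix _ xN.
  have := count_predC e (iota 1 x); rewrite size_iota cN.
  move: (count e _) (count (predC e) _) (dyck_height (iota _ _) _)
    (dyck_height xi _) => E O hN hx xE OE EN eN ex.
  rewrite -[in RHS](@subnK E (minn x N)); last by lia.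
  (* [2 * E - x] is the height of the lower path; the truncated subtraction is exact because
     [O <= E] and [O + E = x]. *)
  congr (_ + _); rewrite -[RHS](@card_parity_interval (2 * E - x) _ N); last by lia.
  rewrite -sum1dep_card [RHS]big_mkcond /=; apply: eq_bigr => y _.
  by congr (if _ then _ else _); lia.
(* The identity is applied to both paths, each with [N] up steps. The highest path has no down step
   before an up step, so the difference of the two prefix sums is the wanted number of pairs. *)
have := npairs_iota_sum e (2 * N); have := npairs_iota_sum (fun y => y <= N) (2 * N).
rewrite -(eq_bigr _ (fun x _ => box x)) big_split /= cN.
have -> : count e (iota 1 (2 * N)) = N by rewrite -size_filter.
have -> : npairs (fun x y => ~~ (x <= N) && (y <= N)) (iota 1 (2 * N)) = 0.
  elim: (2 * N) {1}1 => [|T IH] // k; rewrite /= IH addn0.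
  by apply/eqP; rewrite -leqn0 leqNgt -has_count; apply/hasPn => y;
     rewrite mem_iota; lia.
rewrite (minn_idPr _); lia.
Qed.

(** * Splitting pair counts, blocks of length [l], and lists of positions of letters *)

Lemma npairs_addn3 (T : eqType) (P P1 P2 P3 : rel T) (s : seq T) :
  {in s &, forall x y, (P x y : nat) = P1 x y + P2 x y + P3 x y} ->
  npairs P s = npairs P1 s + npairs P2 s + npairs P3 s.
Proof.
elim: s => [|x s IH] //= H.
have -> : npairs P s = npairs P1 s + npairs P2 s + npairs P3 s.
  by apply: IH => y z ys zs; apply: H; rewrite inE ?ys ?zs orbT.
have : {in s, forall y, (P x y : nat) = P1 x y + P2 x y + P3 x y}.
  by move=> y ys; apply: H; rewrite inE ?eqxx ?ys ?orbT.
elim: s {IH H} => [|y s IH] //= H.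
have Hy : (P x y : nat) = P1 x y + P2 x y + P3 x y by apply: H; rewrite inE eqxx.
have : {in s, forall y, (P x y : nat) = P1 x y + P2 x y + P3 x y}.
  by move=> z zs; apply: H; rewrite inE zs orbT.
by move/IH; lia.
Qed.

Lemma count_flatten_nseq (T : Type) (p : pred T) (l : nat) (s : seq T) :
  count p (flatten [seq nseq l k | k <- s]) = l * count p s.
Proof.
elim: s => [|k s IH] /=; first by rewrite muln0.
by rewrite count_cat IH count_nseq; lia.
Qed.

(** Bridges the quotient and remainder indexing of [phi], [even_part] and [odd_part] and the
    concatenation of position lists. *)
Lemma mkseq_flatten (l : nat) (ss : seq (seq nat)) : 0 < l ->
  all (fun s => size s == l) ss ->
  mkseq (fun i => nth 0 (nth [::] ss (i %/ l)) (i %% l)) (l * size ss)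
    = flatten ss.
Proof.
move=> l0; elim: ss => [|s ss IH] /=; first by rewrite muln0.
case/andP=> /eqP sz /IH {}IH.
rewrite mulnS /mkseq iotaD map_cat -IH; congr (_ ++ _).
  rewrite -[RHS](mkseq_nth 0) sz; apply/eq_in_map => i.
  by rewrite mem_iota add0n => /= il; rewrite divn_small // modn_small.
rewrite addnC iotaDl -map_comp; apply: eq_map => i /=.
by rewrite divnDl // divnn l0 add1n /= modnDl.
Qed.

Definition letter (w : seq nat) (x : nat) : nat := nth 0 w x.-1.

Lemma map_letter (w : seq nat) : [seq letter w x | x <- iota 1 (size w)] = w.
Proof.
rewrite (iotaDl 1 0) -map_comp -[RHS](mkseq_nth 0).
by apply: eq_map => i.
Qed.

Lemma take_letter (w : seq nat) (t : nat) : t <= size w ->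
  take t w = [seq letter w x | x <- iota 1 t].
Proof.
by move=> tw; rewrite -{1}(map_letter w) -map_take take_iota (minn_idPl tw).
Qed.

Lemma size_positions (k : nat) (w : seq nat) :
  size (positions k w) = count_mem k w.
Proof. by rewrite size_filter -{3}(map_letter w) count_map. Qed.

Lemma mem_flatten_positions (w ks : seq nat) (x : nat) :
  (x \in flatten [seq positions k w | k <- ks])
    = (letter w x \in ks) && (x \in iota 1 (size w)).
Proof.
elim: ks => [|k ks IH] //=.
by rewrite mem_cat IH mem_filter in_cons andb_orl.
Qed.

(** The order in which [phi] lists positions: by letter, then from left to right. *)
Definition letter_lt (w : seq nat) : rel nat := fun x y =>
  (letter w x < letter w y) || (letter w x == letter w y) && (x < y).

Lemma letter_lt_asym (w : seq nat) (x y : nat) :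
  letter_lt w x y -> ~~ letter_lt w y x.
Proof. by rewrite /letter_lt; lia. Qed.

Lemma pairwise_flatten_positions (w ks : seq nat) : sorted ltn ks ->
  pairwise (letter_lt w) (flatten [seq positions k w | k <- ks]).
Proof.
rewrite sorted_pairwise; last exact: ltn_trans.
elim: ks => [|k ks IH] //= /andP[kks /IH {}IH].
rewrite pairwise_cat IH andbT; apply/andP; split.
  apply/allrelP => x y; rewrite mem_filter mem_flatten_positions.
  case/andP=> xk _ /andP[yk _]; move: (allP kks _ yk) => /=.
  by rewrite /letter_lt; move: xk; rewrite -/(letter w x) => /eqP ->; lia.
have : pairwise ltn (positions k w).
  apply: pairwise_filter; rewrite -sorted_pairwise; last exact: ltn_trans.
  exact: iota_ltn_sorted.
apply: (sub_in_pairwise (P := [in positions k w])); last exact/allP.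
move=> x y; rewrite !mem_filter -/(letter w x) -/(letter w y).
by rewrite /letter_lt /=; lia.
Qed.

Lemma perm_flatten_positions (w ks : seq nat) : sorted ltn ks ->
  perm_eq (flatten [seq positions k w | k <- ks])
          [seq x <- iota 1 (size w) | letter w x \in ks].
Proof.
move=> sk; apply: uniq_perm; last 1 first.
- by move=> x; rewrite mem_flatten_positions mem_filter.
- apply: (pairwise_uniq (r := letter_lt w)).
    by move=> x; rewrite /letter_lt; lia.
  exact: pairwise_flatten_positions.
- by rewrite filter_uniq // iota_uniq.
Qed.

(** A permutation and its inverse have equally many inversions: a position listed before a smaller
    one carries a strictly smaller letter, which is a descent of [w] read the other way round. Both
    sides become double sums, one ordered by [letter_lt] and one by [ltn], with the two indices
    exchanged. *)
Lemma inv_word_flatten_positions (w ks : seq nat) : sorted ltn ks ->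
  inv_word (flatten [seq positions k w | k <- ks])
    = npairs (fun a b => [&& a \in ks, b \in ks & b < a]) w.
Proof.
move=> sk; rewrite inv_wordE.
rewrite (npairs_pairwise _ (letter_lt w)); last 2 first.
- exact: letter_lt_asym.
- exact: pairwise_flatten_positions.
rewrite -[in RHS](map_letter w) npairs_map.
rewrite [RHS](npairs_pairwise _ ltn); last 2 first.
- by move=> x y /=; lia.
- by rewrite -sorted_pairwise; [exact: iota_ltn_sorted|exact: ltn_trans].
rewrite (perm_big _ (perm_flatten_positions w _ sk)) /= [RHS]exchange_big /=.
rewrite big_filter big_mkcond /=; apply: eq_bigr => x _.
rewrite (perm_big _ (perm_flatten_positions w _ sk)) /= big_filter.
case: (_ \in ks); last by rewrite big1 // => y _; rewrite !andbF.
rewrite big_mkcond /=; apply: eq_bigr => y _.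
by case: (_ \in ks); rewrite /letter_lt /= ?andbF //; lia.
Qed.

(** * Words with [l] copies of each letter 1, ..., 2M and a prefix condition *)

Lemma count_even_iota (k : nat) : count (predC odd) (iota 1 (2 * k)) = k.
Proof. by elim: k => // k IH; rewrite mulnS addnC iotaD count_cat IH /=; lia. Qed.

(** The three patterns in one relation: after an odd letter every even letter counts, whatever its
    size; letters of equal parity count when they descend. *)
Definition word_pair : rel nat := fun a b =>
  if odd a then odd b ==> (b < a) else ~~ odd b && (b < a).

Section Word.

Variables (l M : nat) (w : seq nat).
Hypotheses (l0 : 0 < l)
  (perm_w : perm_eq w (flatten [seq nseq l k | k <- iota 1 (2 * M)]))
  (prefix_w : forall t, count odd (take t w) <= count (predC odd) (take t w)).

(** The construction of [phi] for an arbitrary word, independent of any configuration of dots. *)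
Let phi_w := mkseq (fun j => nth 0 (positions (j %/ l).+1 w) (j %% l)) (size w).
Let evens := [seq 2 * p + 2 | p <- iota 0 M].
Let odds := [seq 2 * p + 1 | p <- iota 0 M].

Lemma count_w (p : pred nat) : count p w = l * count p (iota 1 (2 * M)).
Proof. by rewrite -count_flatten_nseq; apply/permP. Qed.

Lemma size_w : size w = 2 * (M * l).
Proof. by rewrite -count_predT count_w count_predT size_iota; lia. Qed.

Lemma mem_w (a : nat) : a \in w -> 0 < a <= 2 * M.
Proof.
rewrite -has_pred1 has_count count_w muln_gt0 => /andP[_].
by rewrite -has_count has_pred1 mem_iota; lia.
Qed.

Lemma mem_evens (a : nat) : a \in w -> (a \in evens) = ~~ odd a.
Proof.
move=> /mem_w aM; apply/mapP/idP => [[p _ ->]|ea]; first by lia.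
by exists (a./2.-1); rewrite ?mem_iota; lia.
Qed.

Lemma mem_odds (a : nat) : a \in w -> (a \in odds) = odd a.
Proof.
move=> /mem_w aM; apply/mapP/idP => [[p _ ->]|ea]; first by lia.
by exists (a./2); rewrite ?mem_iota; lia.
Qed.

Lemma sorted_affine (c s k : nat) : sorted ltn [seq 2 * p + c | p <- iota s k].
Proof.
rewrite sorted_map; apply: sub_sorted (iota_ltn_sorted _ _).
by move=> x y /=; lia.
Qed.

(** The letter 2p + c fills the block of [phi_w] numbered 2p + c - 1 from 0; c = 1 yields [odd_part]
    and c = 2 yields [even_part]. *)
Lemma flatten_positions_affine (c : nat) : 0 < c <= 2 ->
  flatten [seq positions k w | k <- [seq 2 * p + c | p <- iota 0 M]]
  = mkseq (fun i => nth 0 phi_w (l * (2 * (i %/ l) + c.-1) + i %% l)) (M * l).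
Proof.
move=> c12; rewrite -(mkseq_flatten l) //; last first.
  apply/allP => _ /mapP[k /mapP[p + ->] ->]; rewrite mem_iota => pM.
  rewrite size_positions count_w count_uniq_mem ?iota_uniq // mem_iota; lia.
rewrite !size_map size_iota mulnC; apply/eq_in_map => i.
rewrite mem_iota add0n => /= iMl.
have ilM : i %/ l < M by rewrite ltn_divLR.
have il : i %% l < l by rewrite ltn_mod.
rewrite nth_mkseq; last by rewrite size_w; nia.
rewrite -map_comp (nth_map 0) ?size_iota // nth_iota //=.
rewrite [l * _]mulnC divnMDl // [(i %% l) %/ l]divn_small // modnMDl modn_mod.
by congr (nth 0 (positions _ _) _); lia.
Qed.

Lemma even_partE : even_part l phi_w = flatten [seq positions k w | k <- evens].
Proof.
rewrite flatten_positions_affine // /even_part size_mkseq size_w.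
by rewrite (_ : (2 * (M * l))./2 = M * l) //; lia.
Qed.

Lemma odd_partE : odd_part l phi_w = flatten [seq positions k w | k <- odds].
Proof.
rewrite flatten_positions_affine // /odd_part size_mkseq size_w.
rewrite (_ : (2 * (M * l))./2 = M * l); last lia.
apply: eq_mkseq => i; congr (nth 0 _ _); nia.
Qed.

Let e (x : nat) := ~~ odd (letter w x).

Lemma sort_even_part :
  sort leq (even_part l phi_w) = [seq x <- iota 1 (2 * (M * l)) | e x].
Proof.
rewrite even_partE -size_w.
apply: (sorted_eq leq_trans anti_leq).
- exact: sort_sorted leq_total _.
- by apply: sorted_filter (iota_sorted _ _); apply: leq_trans.
rewrite perm_sort; apply: perm_trans (perm_flatten_positions _ _ _) _.
  exact: sorted_affine.
have -> // : [seq x <- iota 1 (size w) | letter w x \in evens]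
  = [seq x <- iota 1 (size w) | e x].
apply/eq_in_filter => x; rewrite mem_iota => xw.
by apply: mem_evens; apply: mem_nth; case: x xw.
Qed.

Lemma prefix_letter (x : nat) : x <= 2 * (M * l) ->
  count (predC e) (iota 1 x) <= count e (iota 1 x).
Proof.
rewrite -size_w => xw; move: (prefix_w x); rewrite take_letter // !count_map.
by congr (_ <= _); apply: eq_count => y /=; rewrite negbK.
Qed.

Lemma size_even_filter : size [seq x <- iota 1 (2 * (M * l)) | e x] = M * l.
Proof.
rewrite size_filter -size_w.
rewrite -[LHS](count_map (letter w) (predC odd)) map_letter count_w mulnC.
congr (_ * _).
exact: count_even_iota.
Qed.

(** Before the entry [x] numbered [i] from 0 stand exactly [i] positions of even letters, hence x -
    1 - i positions of odd ones; the prefix condition bounds the latter by [i]. *)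
Lemma dyck_seq_sort : dyck_seq (sort leq (even_part l phi_w)).
Proof.
rewrite sort_even_part; set n := 2 * (M * l); split.
- by apply: sorted_filter (iota_ltn_sorted _ _); apply: ltn_trans.
- by apply/allP => x; rewrite mem_filter mem_iota => /andP[_ /andP[]].
move=> i isz; set E := filter _ _ in isz *; set x := nth 0 E i.
have xE : x \in E by apply: mem_nth.
have uE : uniq E by rewrite filter_uniq // iota_uniq.
have [ex xn] : e x /\ 0 < x <= n.
  by move: xE; rewrite mem_filter mem_iota => /andP[-> ?]; split => //; lia.
have Ei : count e (iota 1 x.-1) = i.
  rewrite -(index_uniq 0 isz uE) -/x /E.
  have -> : n = x.-1 + (1 + (n - x)) by lia.
  rewrite !iotaD !filter_cat /= add1n prednK ?ex; last by lia.
  have nx : x \notin [seq y <- iota 1 x.-1 | e y].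
    by rewrite mem_filter mem_iota; lia.
  by rewrite index_cat (negPf nx) /= eqxx addn0 size_filter.
have := prefix_letter x.-1; have := count_predC e (iota 1 x.-1).
by rewrite size_iota Ei; lia.
Qed.

(** The patterns exclude one another: the area counts odd letters followed by even ones, and the two
    inversion numbers count the descents of each parity. *)
Lemma area_inv_word :
  area (sort leq (even_part l phi_w)) + inv_word (even_part l phi_w)
    + inv_word (odd_part l phi_w) = npairs word_pair w.
Proof.
rewrite sort_even_part area_filter; last 2 first.
- exact: size_even_filter.
- exact: prefix_letter.
rewrite even_partE odd_partE !inv_word_flatten_positions ?sorted_affine //.
(* The double negation reproduces [~~ e x] with [e] unfolded. *)
rewrite -size_w -(npairs_map _ _ (letter w) (fun a b => ~~ ~~ odd a && ~~ odd b)).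
rewrite map_letter; symmetry; apply: npairs_addn3 => x y xw yw.
rewrite !mem_evens // !mem_odds // /word_pair.
by case: (odd x); case: (odd y); case: (y < x).
Qed.

End Word.

(** * Concatenations, balance of prefixes, and the words [step2_word] *)

Lemma pairwise_flatten_map (K T : Type) (r : rel T) (f : K -> seq T) ks :
  pairwise (fun k k' => allrel r (f k) (f k')) ks ->
  all (fun k => pairwise r (f k)) ks -> pairwise r (flatten (map f ks)).
Proof.
elim: ks => //= k ks IH /andP[kks /IH {}IH] /andP[rk /IH {}IH].
rewrite pairwise_cat rk IH !andbT.
elim: ks kks {IH} => [|k' ks IH] /=; first by rewrite allrel0r.
by case/andP=> rkk' /IH {}IH; rewrite allrel_catr rkk'.
Qed.

Lemma npairs_eq0 (T : Type) (P : rel T) (s : seq T) :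
  pairwise (fun x y => ~~ P x y) s -> npairs P s = 0.
Proof.
elim: s => //= x s IH /andP[Px /IH ->].
by rewrite addn0; apply/eqP; rewrite -leqn0 leqNgt -has_count -all_predC.
Qed.

Lemma npairs_cat_allrel (T : Type) (P : rel T) (s1 s2 : seq T) :
  allrel (fun x y => ~~ P x y) s1 s2 ->
  npairs P (s1 ++ s2) = npairs P s1 + npairs P s2.
Proof.
rewrite npairs_cat; elim: s1 => [|x s1 IH]; first by rewrite big_nil addn0.
rewrite allrel_consl big_cons => /andP[xs2 /IH /= {}IH].
have -> : count (P x) s2 = 0.
  by apply/eqP; rewrite -leqn0 leqNgt -has_count -all_predC.
by lia.
Qed.

(** With even letters before odd ones, the excess of odd letters first falls and then rises, so it
    is largest at one of the two ends. [a] and [b] stand for the odd and even letters already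
    read. *)
Lemma take_prefix_balance (a b t : nat) (s : seq nat) :
  pairwise (fun x y => odd x ==> odd y) s -> a <= b ->
  a + count odd s <= b + count (predC odd) s ->
  a + count odd (take t s) <= b + count (predC odd) (take t s).
Proof.
move=> ps ab; rewrite -{1 2 3}(cat_take_drop t s) in ps *.
move: ps; rewrite pairwise_cat !count_cat => /andP[/allrelP td _].
case: (boolP (has odd (take t s))) => [/hasP[x xs ox]|].
  have -> : count (predC odd) (drop t s) = 0; last by lia.
  apply/eqP; rewrite -leqn0 leqNgt -has_count; apply/hasPn => y ys.
  by have := td _ _ xs ys; rewrite ox /= => ->.
by rewrite has_count -leqNgt leqn0 => /eqP ->; lia.
Qed.

(** Only the ends of blocks need checking; [a] and [b] absorb the counts of each block passed. *)
Lemma flatten_prefix_balance (a b : nat) (ss : seq (seq nat)) :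
  all (pairwise (fun x y => odd x ==> odd y)) ss ->
  (forall k, a + count odd (flatten (take k ss))
             <= b + count (predC odd) (flatten (take k ss))) ->
  forall t, a + count odd (take t (flatten ss))
            <= b + count (predC odd) (take t (flatten ss)).
Proof.
elim: ss a b => [|s ss IH] a b /=; first by move=> _ H t; apply: (H 0).
case/andP=> ps pss H t.
have ab : a <= b by have := H 0; rewrite /= !addn0.
have H1 := H 1; rewrite /= take0 cats0 in H1.
rewrite take_cat; case: ltnP => ts; first exact: take_prefix_balance.
rewrite !count_cat !addnA; apply: IH => // k.
by have := H k.+1; rewrite /= !count_cat !addnA.
Qed.

Lemma mem_step2_word (l a b x : nat) :
  x \in step2_word l a b -> (a <= x <= b) && (odd x == odd a).
Proof.
case/flatten_mapP=> k; rewrite mem_filter mem_iota mem_nseq.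
by move=> H /andP[_ /eqP ->]; lia.
Qed.

Lemma pairwise_step2_word (l a b : nat) : pairwise leq (step2_word l a b).
Proof.
apply: pairwise_flatten_map.
  have : pairwise ltn [seq k <- iota a (b.+1 - a) | odd k == odd a].
    by apply: pairwise_filter; rewrite -sorted_pairwise;
      [exact: iota_ltn_sorted|exact: ltn_trans].
  apply: sub_pairwise => x y /= xy; apply/allrelP => u v.
  by rewrite !mem_nseq => /andP[_ /eqP ->] /andP[_ /eqP ->]; apply: ltnW.
apply/allP => k _; elim: l => //= l ->; rewrite andbT.
by apply/allP => y; rewrite mem_nseq => /andP[_ /eqP ->].
Qed.

(** * Sums over rows, and enumerations of ordinals *)

Lemma sum_interval_leq (K a b : nat) : \sum_(i < K | a <= i < b) 1 <= b - a.
Proof.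
suff : \sum_(i < K | a <= i < b) 1 <= minn K b - a by lia.
elim: K => [|K IH]; first by rewrite big_ord0.
rewrite big_mkcond big_ord_recr /= -big_mkcond /=.
by move: (\sum_(_ < _ | _) _) IH => s IH; case: ifP; lia.
Qed.

(** The term of index [r] is the number of integers below [c] in the interval from lr to lr + l - 1,
    and these intervals tile the integers below lk. *)
Lemma sum_low_rows (l c k : nat) :
  \sum_(r < k) (l - (l * r.+1 - c)) = minn c (l * k).
Proof.
elim: k => [|k IH]; first by rewrite big_ord0 muln0 minn0.
by rewrite big_ord_recr /= IH mulnS; lia.
Qed.

(** Rows from [h] to [A - 1] are bounded by [l] each; from row [A] on, the terms are again the parts
    below [c] of consecutive intervals of length [l]. *)
Lemma sum_high_rows (l c h A k : nat) : h <= A ->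
  \sum_(r < k | h <= r) minn l (c - l * (r - A))
    <= l * (minn k A - h) + minn c (l * (k - A)).
Proof.
move=> hA; elim: k => [|k IH]; first by rewrite big_ord0.
rewrite big_mkcond big_ord_recr /= -big_mkcond /=.
move: (\sum_(_ < _ | _) _) IH => s IH.
case: (leqP h k) => hk; case: (leqP A k) => Ak.
- have -> : minn k.+1 A = minn k A by lia.
  have -> : k.+1 - A = (k - A).+1 by lia.
  by rewrite mulnS; lia.
- have -> : minn k.+1 A - h = (minn k A - h).+1 by lia.
  have -> : k.+1 - A = 0 by lia.
  have kA : k - A = 0 by lia.
  by rewrite kA in IH *; rewrite mulnS; lia.
- by lia.
- have -> : minn k.+1 A - h = minn k A - h by lia.
  have -> : k.+1 - A = k - A by lia.
  by lia.
Qed.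

Lemma take_enum_ord (W k : nat) :
  take k (enum 'I_W) = [seq c : 'I_W <- enum 'I_W | c < k].
Proof.
apply: (inj_map val_inj); rewrite map_take val_enum_ord.
rewrite -(filter_map _ (fun i => i < k)) val_enum_ord.
case: (leqP k W) => [/subnKC <-|Wk].
  rewrite take_iota (minn_idPl _) ?leq_addr // iotaD filter_cat.
  rewrite (all_filterP _); last by apply/allP => i; rewrite mem_iota.
  rewrite -[LHS]cats0; congr (_ ++ _); apply/esym/eqP.
  by rewrite -[_ == _]negbK -has_filter; apply/hasPn => i; rewrite mem_iota; lia.
rewrite take_oversize ?size_iota ?(ltnW Wk) //; apply/esym/all_filterP/allP => i.
by rewrite mem_iota; lia.
Qed.

Lemma sum_pair (I J : finType) (F : I * J -> nat) :
  \sum_p F p = \sum_i \sum_j F (i, j).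
Proof. by rewrite (pair_bigA _ (fun i j => F (i, j))); apply: eq_bigr => -[]. Qed.

Lemma pairwise_enum_ord (W : nat) :
  pairwise (fun i j : 'I_W => i < j) (enum 'I_W).
Proof.
rewrite -(pairwise_map val ltn) val_enum_ord -sorted_pairwise.
  exact: iota_ltn_sorted.
exact: ltn_trans.
Qed.

Lemma npairs_step2_word (l a b : nat) : npairs word_pair (step2_word l a b) = 0.
Proof.
apply: npairs_eq0; have := pairwise_step2_word l a b.
apply: (sub_in_pairwise (P := [in step2_word l a b])); last exact/allP.
move=> x y /mem_step2_word/andP[_ /eqP ox] /mem_step2_word/andP[_ /eqP oy].
by rewrite /word_pair ox oy leqNgt; case: odd => /= /negPf ->.
Qed.

(** * Labels and letters of a generalized Dellac configuration *)

Section Dellac.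

Variables (l m n : nat) (C : {set 'I_(l * n) * 'I_(m * n)}).
Hypotheses (hl : 1 <= l) (hm : 2 <= m) (hn : 1 <= n) (hC : dellac C).

Let h := (m * n)./2.
Let A := (m - 1) * n.
(** [2 * M] is the largest letter; the boolean absorbs the parity of mn, so that labels, [w1] and
    [w2] each get a single formula. *)
Let M := A + ~~ odd (m * n).

Lemma mnE : m * n = A + n.
Proof. by rewrite /A mulnBl mul1n subnK //; nia. Qed.

Lemma A_ge : n <= A.
Proof. by rewrite /A; nia. Qed.

Lemma labelE (r : nat) :
  label m n r = if r <= h then 2 * (r + (M - h)) else 2 * (r - h) - 1.
Proof.
rewrite /label -/h; case: (r <= h) => //.
have := mnE; have : n * (m - 2) = A - n by rewrite /A; nia.
have := A_ge; rewrite /M /h.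
by move=> H -> E; case: ifP => /= o; lia.
Qed.

Lemma w1E : w1 l m n = step2_word l 2 (2 * (M - h)).
Proof.
rewrite /w1; have := mnE; have : n * (m - 2) = A - n by rewrite /A; nia.
have := A_ge; rewrite /M /h [(m - 2) * n]mulnC.
by move=> H -> E; case: ifP => /= o; congr step2_word; lia.
Qed.

Lemma w2E : w2 l m n = step2_word l (2 * (m * n - h) + 1) (2 * M - 1).
Proof.
rewrite /w2; have := mnE; rewrite -!mulnA [n * (m - 1)]mulnC -/A.
have := A_ge; rewrite /M /h.
by move=> H E; case: ifP => /= o; congr step2_word; lia.
Qed.

Let values := [seq k <- iota 2 ((2 * (M - h)).+1 - 2) | odd k == odd 2]
  ++ [seq label m n r.+1 | r <- iota 0 (m * n)]
  ++ [seq k <- iota (2 * (m * n - h) + 1) ((2 * M - 1).+1 - (2 * (m * n - h) + 1))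
      | odd k == odd (2 * (m * n - h) + 1)].

(** Even letters up to 2(M - h) come from [w1] and the rest from low rows; odd letters below 2(mn -
    h) come from high rows and the rest from [w2]. *)
Lemma perm_values : perm_eq values (iota 1 (2 * M)).
Proof.
have hE := mnE; have nA := A_ge.
have hM : h < M by rewrite /M /h; case: (boolP (odd (m * n))) => /=; lia.
have h2 : h <= m * n <= 2 * h + 1 by rewrite /h; lia.
have Mh : m * n - h <= M by rewrite /M /h; case: (boolP (odd (m * n))) => /=; lia.
apply: uniq_perm; first 2 last.
- move=> x; rewrite !mem_cat !mem_filter !mem_iota.
  have -> : (x \in [seq label m n r.+1 | r <- iota 0 (m * n)])
    = if odd x then x < 2 * (m * n - h) else 2 * (M - h) < x <= 2 * M.
    apply/mapP/idP => [[r]|].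
      by rewrite mem_iota labelE => rmn ->; case: (ltnP r h) => rh; case: ifP => o; lia.
    case: ifP => ox xb.
      (* The witnesses are the rows, numbered from 0, found by solving [labelE] for the label
         [x]. *)
      by exists (h + x./2); rewrite ?mem_iota ?labelE; [|case: ifP]; lia.
    by exists ((x./2 - (M - h)).-1); rewrite ?mem_iota ?labelE; [|case: ifP]; lia.
  by case: ifP => ox; lia.
- rewrite !cat_uniq !filter_uniq ?iota_uniq // map_inj_in_uniq ?iota_uniq.
    rewrite /= andbT; apply/andP; split.
      apply/hasPn => x; rewrite mem_cat !mem_filter !mem_iota.
      case/orP=> [/mapP[r]|]; last by lia.
      by rewrite mem_iota labelE => rmn ->; case: ifP => rh; lia.
    apply/hasPn => x; rewrite !mem_filter !mem_iota => H; apply/mapP=> -[r].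
    by rewrite mem_iota labelE => rmn; case: ifP => rh; lia.
  move=> r r'; rewrite !mem_iota !labelE => rm rm'.
  by case: ifP => rh; case: ifP => rh'; lia.
- exact: iota_uniq.
Qed.

(** * Dots in the first columns *)

Lemma row_card (r : 'I_(m * n)) : \sum_(c < l * n) ((c, r) \in C) = l.
Proof.
case: hC => _ /(_ r) rowC _ _; rewrite -[RHS]rowC -sum1dep_card [RHS]big_mkcond.
rewrite sum_pair; apply: eq_bigr => c _ /=; rewrite (bigD1 r) //= eqxx andbT.
rewrite big1 ?addn0; first by case: (_ \in C).
by move=> r' /negPf ->; rewrite andbF.
Qed.

Lemma mem_dellac (c : 'I_(l * n)) (r : 'I_(m * n)) :
  (c, r) \in C -> l * (r - A) <= c < l * r.+1.
Proof.
case: hC => _ _ _ dC /dC /=; rewrite -/A => /andP[lo up].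
rewrite (mulnC l (r - A)) (mulnC l r.+1) -leq_divRL // -ltn_divLR // lo andbT.
by rewrite leq_subLR addnC.
Qed.

Lemma low_dots (c : nat) : c <= l * n ->
  c <= \sum_(r < m * n | r < h) \sum_(j < l * n | j < c) ((j, r) \in C).
Proof.
have hmn : h <= m * n by rewrite /h; lia.
move=> cln; apply: (@leq_trans (\sum_(r < m * n | r < h) (l - (l * r.+1 - c)))).
  rewrite -(big_ord_widen _ (fun r => l - (l * r.+1 - c)) hmn) sum_low_rows.
  (* Here n <= h, since m >= 2, so the minimum is [c]. *)
  by rewrite leq_min leqnn /=; apply: leq_trans cln _; rewrite leq_mul2l /h; nia.
apply: leq_sum => r rh; rewrite leq_subLR -[leqLHS](row_card r).
(* The dots of row [r] from column [c] on lie left of column [l * r.+1], hence number at most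
   [l * r.+1 - c]. *)
rewrite (bigID (fun j : 'I_(l * n) => j < c)) /= addnC leq_add2r.
apply: leq_trans (sum_interval_leq (l * n) c (l * r.+1)).
rewrite [leqLHS]big_mkcond [leqRHS]big_mkcond; apply: leq_sum => j _ /=.
case: ltnP => //= cj; by case: (boolP (_ \in C)) => // /mem_dellac /andP[_ ->].
Qed.

Lemma high_dots (c : nat) :
  \sum_(r < m * n | h <= r) \sum_(j < l * n | j < c) ((j, r) \in C)
    <= l * (A - h) + c.
Proof.
have hA : h <= A by have := mnE; have := A_ge; rewrite /h; lia.
apply: (@leq_trans (\sum_(r < m * n | h <= r) minn l (c - l * (r - A)))).
  apply: leq_sum => r hr; rewrite leq_min; apply/andP; split.
    rewrite -[leqRHS](row_card r) big_mkcond; apply: leq_sum => j _.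
    by case: ifP.
  apply: leq_trans (sum_interval_leq (l * n) _ _).
  rewrite [leqLHS]big_mkcond [leqRHS]big_mkcond; apply: leq_sum => j _ /=.
  case: (ltnP j c) => jc; rewrite ?andbF // andbT.
  by case: (boolP (_ \in C)) => // /mem_dellac /andP[-> _].
apply: leq_trans (sum_high_rows _ _ _ _ _ hA) _.
rewrite mnE (minn_idPr (leq_addr _ _)); lia.
Qed.

(** * The letters of [word C] and [phi1 C], and their prefixes *)

Let column (c : 'I_(l * n)) : seq nat :=
  [seq label m n r.+1 | r : 'I_(m * n) <- enum 'I_(m * n) & (c, r) \in C].

Lemma count_columns (p : pred nat) (cs : seq 'I_(l * n)) :
  count p (flatten [seq column c | c <- cs])
    = \sum_(r < m * n | p (label m n r.+1)) \sum_(c <- cs) ((c, r) \in C).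
Proof.
rewrite exchange_big count_flatten sumnE !big_map; apply: eq_bigr => c _.
rewrite count_map count_filter -sum1_count big_enum_cond /=.
rewrite big_mkcond [RHS]big_mkcond; apply: eq_bigr => r _ /=.
by case: (p _); case: (_ \in C).
Qed.

Lemma perm_word :
  perm_eq (word C)
    (flatten [seq nseq l k | k <- [seq label m n r.+1 | r <- iota 0 (m * n)]]).
Proof.
apply/permP => p; rewrite count_flatten_nseq count_map.
rewrite count_columns -(val_enum_ord (m * n)) count_map -sum1_count big_enum_cond.
rewrite big_distrr /=; apply: eq_bigr => r _.
by rewrite muln1 -[RHS](row_card r) big_enum.
Qed.

Lemma perm_phi1 :
  perm_eq (phi1 C) (flatten [seq nseq l k | k <- iota 1 (2 * M)]).
Proof.
apply: perm_trans (perm_flatten (perm_map (nseq l) perm_values)).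
rewrite /phi1 w1E w2E /values !map_cat !flatten_cat.
by rewrite perm_cat2l perm_cat2r perm_word.
Qed.

Lemma odd_label (r : 'I_(m * n)) : odd (label m n r.+1) = (h <= r).
Proof. by rewrite labelE; case: (ltnP r h); lia. Qed.

(** The purpose of the labelling: labels increase with the row within the low rows and within the
    high rows, and parity separates the two halves. *)
Lemma word_pair_label (r r' : 'I_(m * n)) :
  word_pair (label m n r.+1) (label m n r'.+1) = (r' < r).
Proof.
rewrite /word_pair !odd_label !labelE.
by case: (ltnP r h); case: (ltnP r' h); lia.
Qed.

Lemma pairwise_column (c : 'I_(l * n)) :
  pairwise (fun x y => odd x ==> odd y) (column c).
Proof.
rewrite pairwise_map; apply: pairwise_filter.
apply: sub_pairwise (pairwise_enum_ord _) => r r' /=; rewrite !odd_label.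
by move=> rr'; apply/implyP => /leq_trans; apply; apply: ltnW.
Qed.

(** The allowance [l * (M - h)] is the number of letters of [w1], all even. Columns list low rows
    first, so only ends of columns matter, where the bounds on low and high dots apply. *)
Lemma prefix_word (t : nat) :
  count odd (take t (word C))
    <= l * (M - h) + count (predC odd) (take t (word C)).
Proof.
apply: (flatten_prefix_balance 0).
  by apply/allP => _ /mapP[c _ ->]; exact: pairwise_column.
move=> k; rewrite add0n -map_take.
wlog kln : k / k <= l * n => [H|].
  case: (leqP k (l * n)) => [|/ltnW kln]; first exact: H.
  by have := H _ (leqnn (l * n)); rewrite !take_oversize ?size_enum_ord.
rewrite !count_columns.
rewrite (eq_bigl (fun r : 'I_(m * n) => h <= r)); last exact: odd_label.
rewrite [X in _ + X](eq_bigl (fun r : 'I_(m * n) => r < h)); last first.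
  by move=> r /=; rewrite odd_label -ltnNge.
have E (r : 'I_(m * n)) : \sum_(c <- take k (enum 'I_(l * n))) ((c, r) \in C)
    = \sum_(c < l * n | c < k) ((c, r) \in C).
  by rewrite take_enum_ord big_filter big_enum_cond.
rewrite (eq_bigr _ (fun r _ => E r)) [X in _ + X](eq_bigr _ (fun r _ => E r)).
apply: leq_trans (high_dots k) _; apply: leq_add; last exact: low_dots.
by rewrite leq_mul2l /M; lia.
Qed.

(** A prefix ending in [w1] has no odd letter, and one ending in [word C] is covered by
    [prefix_word]. For one ending in [w2], the missing letters are all odd while the totals
    agree. *)
Lemma prefix_phi1 (t : nat) :
  count odd (take t (phi1 C)) <= count (predC odd) (take t (phi1 C)).
Proof.
have total : count odd (phi1 C) = count (predC odd) (phi1 C).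
  rewrite !(permP perm_phi1) !count_flatten_nseq; congr (_ * _).
  by elim: M => // k IH; rewrite mulnS addnC iotaD !count_cat IH /=; lia.
have odd1 s : count odd (take s (w1 l m n)) = 0.
  apply/eqP; rewrite -leqn0 leqNgt -has_count; apply/hasPn => x /mem_take.
  by rewrite w1E => /mem_step2_word; lia.
have even1 : count (predC odd) (w1 l m n) = l * (M - h).
  rewrite w1E count_flatten_nseq count_filter; congr (_ * _).
  have hM : h < M by have := mnE; have := A_ge; rewrite /M /h; lia.
  rewrite -[RHS]count_even_iota -(@prednK (M - h)) ?subn_gt0 // mulnS /=.
  rewrite !add0n; congr (_ + _).
  by apply: eq_count => k /=; case: (odd k).
have even2 s : count (predC odd) (drop s (w2 l m n)) = 0.
  apply/eqP; rewrite -leqn0 leqNgt -has_count; apply/hasPn => x /mem_drop.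
  by rewrite w2E => /mem_step2_word /andP[_ /eqP] /= ->; rewrite oddD oddM.
rewrite /phi1 take_cat; case: ltnP => t1; first by rewrite odd1.
rewrite !count_cat -{1}(take_size (w1 l m n)) odd1 even1 add0n.
move: (t - _) => {t t1} t; rewrite take_cat; case: ltnP => t1.
  exact: prefix_word.
move: total; rewrite /phi1 !count_cat -{1}(take_size (w1 l m n)) odd1 even1.
move: (t - _) => {t t1} t.
rewrite -{1 2}(cat_take_drop t (w2 l m n)) !count_cat even2.
by lia.
Qed.

(** * Inversions of dots as patterns of letters *)

(** Even letters of [w1] are smaller than those of [word C], and odd letters of [w2] are larger than
    those of [word C]; an even letter followed by an odd one is never a pattern. *)
Lemma npairs_phi1 : npairs word_pair (phi1 C) = npairs word_pair (word C).
Proof.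
have mem_word x : x \in word C ->
    if odd x then x < 2 * (m * n - h) + 1 else 2 * (M - h) < x.
  case/flatten_mapP=> c _ /mapP[r _ ->]; have := ltn_ord r.
  by rewrite odd_label labelE; case: (ltnP r h); lia.
rewrite /phi1 w1E w2E !npairs_cat_allrel.
- by rewrite !npairs_step2_word addn0.
- apply/allrelP => x y /mem_word xw /mem_step2_word yw.
  case/andP: yw => yb; rewrite oddD oddM /= => /eqP oy.
  by rewrite /word_pair oy; case: (odd x) xw => //=; lia.
- apply/allrelP => x y /mem_step2_word/andP[xb /eqP ox].
  rewrite /word_pair ox mem_cat => /orP[/mem_word|/mem_step2_word/andP[_]].
    by case: (odd y) => //=; lia.
  by rewrite oddD oddM => /eqP ->.
Qed.

Lemma inv_dots_word : inv_dots C = npairs word_pair (word C).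
Proof.
pose dots := flatten [seq [seq (c, r) | r <- enum 'I_(m * n) & (c, r) \in C]
                     | c <- enum 'I_(l * n)].
have -> : word C = [seq label m n d.2.+1 | d : 'I_(l * n) * 'I_(m * n) <- dots].
  rewrite map_flatten -map_comp /word; congr flatten; apply: eq_map => c /=.
  by rewrite -map_comp.
(* The reading order of the dots: by column, then upwards. *)
pose lex (d d' : 'I_(l * n) * 'I_(m * n)) :=
  (d.1 < d'.1) || (d.1 == d'.1 :> nat) && (d.2 < d'.2).
have sum_dots (F : 'I_(l * n) * 'I_(m * n) -> nat) :
    \sum_(d <- dots) F d = \sum_(d in C) F d.
  rewrite big_flatten big_map big_enum_cond [RHS]big_mkcond /=.
  rewrite sum_pair; apply: eq_bigr => c _.
  by rewrite big_map big_filter big_enum_cond -big_mkcond.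
rewrite npairs_map (npairs_pairwise _ lex); last 2 first.
- by move=> [c r] [c' r']; rewrite /lex /=; lia.
- apply: pairwise_flatten_map.
    apply: sub_pairwise (pairwise_enum_ord _) => c c' cc'; apply/allrelP.
    by move=> _ _ /mapP[r _ ->] /mapP[r' _ ->]; rewrite /lex /= cc'.
  apply/allP => c _; rewrite pairwise_map; apply: pairwise_filter.
  apply: sub_pairwise (pairwise_enum_ord _) => r r' rr'.
  by rewrite /lex /= eqxx rr' orbT.
rewrite sum_dots (eq_bigr _ (fun d _ => sum_dots _)) /inv_dots -sum1dep_card.
rewrite [RHS]pair_big_dep /= [LHS]big_mkcond [RHS]big_mkcond /=.
apply: eq_bigr => -[[c r] [c' r']] _ /=; rewrite word_pair_label /lex /=.
case: (_ \in C); case: (_ \in C) => //=.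
(* In a common column [lex] forces r < r', against r' < r, so only pairs with c < c' remain. *)
by case: (ltngtP c c'); case: (ltngtP r r').
Qed.

End Dellac.

Theorem theorem5p2 (l m n : nat) (hl : 1 <= l) (hm : 2 <= m) (hn : 1 <= n)
    (C : {set 'I_(l * n) * 'I_(m * n)}) (hC : dellac C) :
  let phi_o := odd_part l (phi C) in
  let phi_e := even_part l (phi C) in
  let phi_e_sorted := sort leq phi_e in
  dyck_seq phi_e_sorted /\
  inv_dots C = area phi_e_sorted + inv_word phi_e + inv_word phi_o.
Proof.
have perm_w := perm_phi1 _ _ _ _ hl hm hn hC.
have prefix_w := prefix_phi1 _ _ _ _ hl hm hn hC.
split; first exact: dyck_seq_sort _ _ _ hl perm_w prefix_w.
rewrite inv_dots_word // -npairs_phi1 //.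
by symmetry; exact: area_inv_word _ _ _ hl perm_w prefix_w.
Qed.
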